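(* Each of the two commutative algebras $\mathcal{F}_\infty=\mathbb{C}[[X_0,X_1,X_2,\ldots]]$ and $\mathcal{F}_\infty\oplus\mathcal{F}_\infty$ admits countably many mutually inequivalent Fréchet algebra topologies; that is, on each of these algebras there is a sequence of Fréchet algebra topologies, no two of which coincide.
   Context: $\mathcal{F}_\infty=\mathbb{C}[[X_0,X_1,\ldots]]$ is the algebra of all formal power series (arbitrary formal sums of complex multiples of monomials, including infinitely many monomials of a given degree) in the countably many commuting indeterminates $X_0,X_1,X_2,\ldots$, with the usual product. $\mathcal{F}_\infty\oplus\mathcal{F}_\infty$ is the vector space direct sum with product $(x,m)(y,n)=(xy,\ xn+ym)$. A Fréchet algebra topology on an algebra is a complete metrizable locally convex topology that can be generated by an increasing sequence of submultiplicative seminorms. Two such topologies are equivalent if they are the same topology (equivalently, the identity map is a homeomorphism), and inequivalent otherwise. *)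

(* Defs.v *)
From HB Require Import structures.
From mathcomp Require Import all_boot all_order all_algebra.
From mathcomp Require Import finmap complex.
From mathcomp Require Import monalg.
From mathcomp Require Import all_classical all_reals all_analysis.

Set Implicit Arguments.
Unset Strict Implicit.
Unset Printing Implicit Defensive.

Import Order.TTheory GRing.Theory Num.Theory.
Import numFieldTopology.Exports.

Local Open Scope classical_set_scope.
Local Open Scope ring_scope.

(* {cmonom I} is the type of commutative monomials in the indeterminates X_i,
   i : I; a formal power series is an arbitrary family of coefficients.  It is
   a record, not a function type, so that the pointwise product of functions
   is never inferred for it. *)
Record fps (I : choiceType) (K : comNzRingType) : Type :=
  FPS { coef :> {cmonom I} -> K }.

Section FormalPowerSeries.
Context (I : choiceType) (K : comNzRingType).
Implicit Types (m d a b c : {cmonom I}) (f g h : fps I K) (s : seq {cmonom I}).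

Lemma fpsP f g : coef f =1 coef g -> f = g.
Proof. by case: f g => [f] [g] /= /funext ->. Qed.

HB.instance Definition _ := [isNew for @coef I K].
HB.instance Definition _ := [Choice of fps I K by <:].

Definition fps_zero : fps I K := FPS (fun=> 0).
Definition fps_opp f : fps I K := FPS (fun m => - f m).
Definition fps_add f g : fps I K := FPS (fun m => f m + g m).
Definition fps_scale (k : K) f : fps I K := FPS (fun m => k * f m).

Fact fps_addA : associative fps_add.
Proof. by move=> f g h; apply: fpsP => m; exact: addrA. Qed.

Fact fps_addC : commutative fps_add.
Proof. by move=> f g; apply: fpsP => m; exact: addrC. Qed.

Fact fps_add0 : left_id fps_zero fps_add.
Proof. by move=> f; apply: fpsP => m; exact: add0r. Qed.

Fact fps_addN : left_inverse fps_zero fps_opp fps_add.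
Proof. by move=> f; apply: fpsP => m; exact: addNr. Qed.

HB.instance Definition _ := GRing.isZmodule.Build (fps I K)
  fps_addA fps_addC fps_add0 fps_addN.

Fact fps_scaleA (k l : K) f : fps_scale k (fps_scale l f) = fps_scale (k * l) f.
Proof. by apply: fpsP => m; exact: mulrA. Qed.

Fact fps_scale1 : left_id 1 fps_scale.
Proof. by move=> f; apply: fpsP => m; exact: mul1r. Qed.

Fact fps_scaleDr : right_distributive fps_scale +%R.
Proof. by move=> k f g; apply: fpsP => m; exact: mulrDr. Qed.

Fact fps_scaleDl f : {morph fps_scale^~ f : k l / k + l}.
Proof. by move=> k l; apply: fpsP => m; exact: mulrDl. Qed.

HB.instance Definition _ := GRing.Zmodule_isLmodule.Build K (fps I K)
  fps_scaleA fps_scale1 fps_scaleDr fps_scaleDl.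

(* The sum is finite, by finite_factorisations below. *)
Definition fps_mul f g : fps I K := FPS (fun m =>
  \sum_(ab \in [set ab : {cmonom I} * {cmonom I} | mmul ab.1 ab.2 = m])
     f ab.1 * g ab.2).

Definition fps_one : fps I K := FPS (fun m => (m == mone)%:R).

Lemma finite_divisors m : finite_set [set d : {cmonom I} | exists e, mmul d e = m].
Proof.
pose N := (\max_(i <- finsupp m) m i).+1.
pose F (u : {ffun finsupp m -> 'I_N}) : {cmonom I} :=
  mkcmonom [fsfun i in finsupp m =>
    (if insub i is Some j then u j : nat else 0%N) | 0%N]%fset.
apply: (sub_finite_set _ (finite_image F (@finite_finset _ setT))).
move=> d [e dem]; have dm i : (d i <= m i)%N by rewrite -dem cmM leq_addr.
have dN i : i \in finsupp m -> (d i < N)%N.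
  move=> im; rewrite ltnS (leq_trans (dm i))//.
  by rewrite (big_fsetD1 i)//= leq_maxl.
exists [ffun j => Ordinal (dN (val j) (valP j))] => //.
apply/eqP/cmP => i; rewrite /F cmE /= fsfun_fun.
case: ifPn => [im|]; first by rewrite insubT ffunE.
by rewrite -cmE_eq0 => /eqP mi0; have := dm i; rewrite mi0 leqn0 => /eqP ->.
Qed.

Lemma finite_factorisations m :
  finite_set [set ab : {cmonom I} * {cmonom I} | mmul ab.1 ab.2 = m].
Proof.
apply: sub_finite_set (finite_setX (finite_divisors m) (finite_divisors m)).
by move=> [a b] /= abm; split; [exists b|exists a; rewrite mulmC].
Qed.

Let divs m : seq {cmonom I} :=
  fset_set [set d : {cmonom I} | exists e, mmul d e = m].

Let mem_divs m d : d \in divs m <-> exists e, mmul d e = m.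
Proof.
rewrite /divs in_fset_set; last exact: finite_divisors.
by rewrite inE.
Qed.

Let fps_mulE f g m s : uniq s ->
    (forall a b, mmul a b = m -> (a \in s) && (b \in s)) ->
  fps_mul f g m = \sum_(a <- s) \sum_(b <- s | mmul a b == m) f a * g b.
Proof.
move=> us sP; rewrite /fps_mul /=.
rewrite (fsbigE [seq p <- allpairs pair s s | mmul p.1 p.2 == m]).
- rewrite big_filter_cond big_mkcond big_allpairs_dep /=.
  apply: eq_bigr => a _; rewrite [RHS]big_mkcond; apply: eq_bigr => b _ /=.
  case: eqP => [abm|//] /=; by rewrite mem_set.
- by rewrite filter_uniq// allpairs_uniq// => -[? ?] [? ?] _ _ [-> ->].
- by move=> [a b] /=; rewrite mem_filter => /andP[/eqP].
move=> [a b] /= abm; rewrite mem_filter /= abm eqxx /= => /negP[].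
by have /andP[? ?] := sP _ _ abm; apply/allpairsP; exists (a, b).
Qed.

Fact fps_mulC : commutative fps_mul.
Proof.
move=> f g; apply: fpsP => m.
have us : uniq (divs m) by exact: fset_uniq.
have sP a b : mmul a b = m -> (a \in divs m) && (b \in divs m).
  by move=> abm; apply/andP; split; apply/mem_divs;
    [exists b|exists a; rewrite mulmC].
rewrite !(fps_mulE _ _ us sP).
under eq_bigr do rewrite big_mkcond.
rewrite exchange_big /=; apply: eq_bigr => b _; rewrite [RHS]big_mkcond.
by apply: eq_bigr => a _; rewrite mulmC mulrC.
Qed.

Let big_unique s (a : {cmonom I}) (F : {cmonom I} -> K) : uniq s -> a \in s ->
  \sum_(x <- s | a == x) F x = F a.
Proof.
move=> us sa; rewrite big_mkcond (bigD1_seq a) //= eqxx big1 ?addr0// => x xa.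
by rewrite eq_sym (negbTE xa).
Qed.

Let fps_mul3E f g h m (s := divs m) :
  fps_mul (fps_mul f g) h m =
  \sum_(a <- s) \sum_(b <- s) \sum_(c <- s)
    if mmul (mmul a b) c == m then f a * g b * h c else 0.
Proof.
have us : uniq s by exact: fset_uniq.
have sl d e : mmul d e = m -> d \in s by move=> dem; apply/mem_divs; exists e.
have sr d e : mmul d e = m -> e \in s.
  by move=> dem; apply/mem_divs; exists d; rewrite mulmC.
have sP a b : mmul a b = m -> (a \in s) && (b \in s).
  by move=> abm; rewrite (sl _ _ abm) (sr _ _ abm).
rewrite (fps_mulE _ _ us sP).
transitivity (\sum_(x <- s) \sum_(c <- s) \sum_(a <- s) \sum_(b <- s)
   if (mmul a b == x) && (mmul x c == m) then f a * g b * h c else 0).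
  apply: eq_bigr => x _; rewrite big_mkcond; apply: eq_bigr => c _.
  case: eqP => [xcm|_]; last first.
    by rewrite big1// => a _; rewrite big1// => b _; rewrite andbF.
  rewrite (@fps_mulE _ _ _ s us); last first.
    move=> a b abx; apply/andP; split; first by apply: (sl _ (mmul b c)); rewrite mulmA abx.
    by apply: (sl _ (mmul a c)); rewrite mulmA (mulmC b a) abx.
  rewrite mulr_suml; apply: eq_bigr => a _.
  rewrite big_mkcond mulr_suml; apply: eq_bigr => b _.
  by rewrite andbT; case: eqP; rewrite ?mul0r.
rewrite exchange_big /=; under eq_bigr do rewrite exchange_big /=.
rewrite exchange_big /=; apply: eq_bigr => a _.
transitivity (\sum_(c <- s) \sum_(b <- s)
    if mmul (mmul a b) c == m then f a * g b * h c else 0); last first.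
  by rewrite exchange_big.
apply: eq_bigr => c _; rewrite exchange_big /=; apply: eq_bigr => b _.
case: ifPn => [/eqP abcm|abcm].
  rewrite -[RHS](@big_unique s (mmul a b) (fun=> f a * g b * h c))//; last exact: sl abcm.
  rewrite [RHS]big_mkcond; apply: eq_bigr => x _.
  by case: eqP => [<-|//]; rewrite abcm eqxx.
by rewrite big1// => x _; case: eqP => [<-|//]; rewrite (negbTE abcm).
Qed.

Fact fps_mulA : associative fps_mul.
Proof.
move=> f g h; rewrite fps_mulC; apply: fpsP => m; rewrite !fps_mul3E.
under eq_bigr do rewrite exchange_big /=.
rewrite exchange_big /=.
apply: eq_bigr => a _; apply: eq_bigr => b _; apply: eq_bigr => c _.
by rewrite mulmC mulmA mulrC mulrA.
Qed.

Fact fps_mul1 : left_id fps_one fps_mul.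
Proof.
move=> f; apply: fpsP => m.
rewrite /fps_mul /= -(fsbig_widen [set (mone, m)]).
- by rewrite fsbig_set1 /fps_one eqxx mul1r.
- by move=> _ -> /=; rewrite mul1m.
move=> [a b] [/= abm ab1]; rewrite /fps_one.
case: eqP => [a1|]; last by rewrite mul0r.
by case: ab1; rewrite -abm a1 mul1m.
Qed.

Fact fps_mulDl : left_distributive fps_mul +%R.
Proof.
move=> f g h; apply: fpsP => m.
change (fps_mul (f + g) h m = fps_mul f h m + fps_mul g h m); rewrite /fps_mul.
rewrite -fsbig_split; last exact: finite_factorisations.
by apply: eq_fsbigr => ab _ /=; rewrite -mulrDl.
Qed.

Fact fps_one_neq0 : fps_one != 0.
Proof.
apply/eqP => /(congr1 (@coef I K ^~ mone)).
by rewrite /= eqxx => /eqP; rewrite oner_eq0.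
Qed.

HB.instance Definition _ := GRing.Zmodule_isComNzRing.Build (fps I K)
  fps_mulA fps_mulC fps_mul1 fps_mulDl fps_one_neq0.

Fact fps_scaleAl (k : K) f g : k *: (f * g) = (k *: f) * g.
Proof.
apply: fpsP => m.
change (k * fps_mul f g m = fps_mul (k *: f) g m).
rewrite /fps_mul /= fsbig_distrr//; last exact: finite_factorisations.
by apply: eq_fsbigr => ab _; exact: mulrA.
Qed.

HB.instance Definition _ :=
  GRing.Lmodule_isLalgebra.Build K (fps I K) fps_scaleAl.
HB.instance Definition _ := GRing.Lalgebra_isComAlgebra.Build K (fps I K).

End FormalPowerSeries.

(* The vector space A (+) A with product (x, m)(y, n) = (xy, xn + ym); the
   type A * A of pairs already carries the componentwise product. *)
Record dsum (K : comNzRingType) (A : comAlgType K) : Type :=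
  DSum { dsum1 : A ; dsum2 : A }.

Section DirectSum.
Context (K : comNzRingType) (A : comAlgType K).
Implicit Types u v w : dsum A.

Let to_pair u := (dsum1 u, dsum2 u).
Let of_pair (p : A * A) : dsum A := DSum p.1 p.2.
Let to_pairK : cancel to_pair of_pair. Proof. by case. Qed.

HB.instance Definition _ := Choice.copy (dsum A) (can_type to_pairK).

Definition dsum_zero : dsum A := DSum 0 0.
Definition dsum_opp u : dsum A := DSum (- dsum1 u) (- dsum2 u).
Definition dsum_add u v : dsum A :=
  DSum (dsum1 u + dsum1 v) (dsum2 u + dsum2 v).
Definition dsum_scale (k : K) u : dsum A := DSum (k *: dsum1 u) (k *: dsum2 u).
Definition dsum_one : dsum A := DSum 1 0.
Definition dsum_mul u v : dsum A :=
  DSum (dsum1 u * dsum1 v) (dsum1 u * dsum2 v + dsum1 v * dsum2 u).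

Fact dsum_addA : associative dsum_add.
Proof. by move=> u v w; congr DSum; exact: addrA. Qed.

Fact dsum_addC : commutative dsum_add.
Proof. by move=> u v; congr DSum; exact: addrC. Qed.

Fact dsum_add0 : left_id dsum_zero dsum_add.
Proof. by case=> x m; congr DSum; exact: add0r. Qed.

Fact dsum_addN : left_inverse dsum_zero dsum_opp dsum_add.
Proof. by move=> u; congr DSum; exact: addNr. Qed.

HB.instance Definition _ := GRing.isZmodule.Build (dsum A)
  dsum_addA dsum_addC dsum_add0 dsum_addN.

Fact dsum_scaleA (k l : K) u :
  dsum_scale k (dsum_scale l u) = dsum_scale (k * l) u.
Proof. by congr DSum; exact: scalerA. Qed.

Fact dsum_scale1 : left_id 1 dsum_scale.
Proof. by case=> x m; congr DSum; exact: scale1r. Qed.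

Fact dsum_scaleDr : right_distributive dsum_scale +%R.
Proof. by move=> k u v; congr DSum; exact: scalerDr. Qed.

Fact dsum_scaleDl u : {morph dsum_scale^~ u : k l / k + l}.
Proof. by move=> k l; congr DSum; exact: scalerDl. Qed.

HB.instance Definition _ := GRing.Zmodule_isLmodule.Build K (dsum A)
  dsum_scaleA dsum_scale1 dsum_scaleDr dsum_scaleDl.

Fact dsum_mulA : associative dsum_mul.
Proof.
move=> [x m] [y n] [z p]; rewrite /dsum_mul /=; congr DSum; first exact: mulrA.
by rewrite !mulrDr !mulrA addrA (mulrC z x) (mulrC z y).
Qed.

Fact dsum_mulC : commutative dsum_mul.
Proof. by move=> u v; rewrite /dsum_mul mulrC addrC. Qed.

Fact dsum_mul1 : left_id dsum_one dsum_mul.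
Proof. by case=> x m; rewrite /dsum_mul /= !mul1r mulr0 addr0. Qed.

Fact dsum_mulDl : left_distributive dsum_mul +%R.
Proof.
move=> [x m] [y n] [z p]; congr DSum; first exact: mulrDl.
by rewrite /= mulrDl mulrDr addrACA.
Qed.

Fact dsum_one_neq0 : dsum_one != 0.
Proof. by apply/eqP => /(congr1 (@dsum1 K A)) /eqP; rewrite oner_eq0. Qed.

HB.instance Definition _ := GRing.Zmodule_isComNzRing.Build (dsum A)
  dsum_mulA dsum_mulC dsum_mul1 dsum_mulDl dsum_one_neq0.

Fact dsum_scaleAl (k : K) u v : k *: (u * v) = (k *: u) * v.
Proof.
congr DSum; first exact: scalerAl.
by rewrite /= scalerDr scalerAl scalerAr.
Qed.

HB.instance Definition _ :=
  GRing.Lmodule_isLalgebra.Build K (dsum A) dsum_scaleAl.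
HB.instance Definition _ := GRing.Lalgebra_isComAlgebra.Build K (dsum A).

End DirectSum.

Record topology (T : Type) := Topology {
  opens : set_system T ;
  opensT : opens setT ;
  opensI : setI_closed opens ;
  opens_bigU : forall (I : Type) (F : I -> set T),
    (forall i, opens (F i)) -> opens (\bigcup_i F i)
}.

(* V as a topological space for tau: an alias that lets the library's
   topological notions be used with the topology tau. *)
Definition topologized (K : numFieldType) (V : lmodType K) (tau : topology V) :
  Type := V.

Section Topologized.
Context (K : numFieldType) (V : lmodType K) (tau : topology V).

HB.instance Definition _ := GRing.Lmodule.on (topologized tau).
HB.instance Definition _ := isOpenTopological.Build (topologized tau)
  (opensT tau) (@opensI _ tau) (@opens_bigU _ tau).

End Topologized.

(* The laws required by PreTopologicalLmod_isTvs. *)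
Definition locally_convex_topology (K : numFieldType) (V : lmodType K)
    (tau : topology V) : Prop :=
  let X := topologized tau in
  [/\ continuous (fun z : X * X => z.1 + z.2),
      continuous (fun z : K^o * X => z.1 *: z.2) &
      exists2 B : set_system X, (forall b, b \in B -> convex_set b) & basis B].

(* Every Cauchy filter converges, "Cauchy" being relative to the
   translation-invariant uniformity of tau. *)
Definition complete_topology (K : numFieldType) (V : lmodType K)
    (tau : topology V) : Prop :=
  let X := topologized tau in
  forall F : set_system X, ProperFilter F ->
    (fun z : X * X => z.1 - z.2) @ (F, F) --> (0 : X) ->
    exists x : X, F --> x.

Definition metrizable (R : realType) (T : Type) (tau : topology T) : Prop :=
  exists d : T -> T -> R,
    [/\ forall x, d x x = 0,
        forall x y, d x y = 0 -> x = y,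
        forall x y, d x y = d y x,
        forall x y z, d x z <= d x y + d y z &
        forall U : set T, opens tau U <->
          forall x, U x -> exists2 e : R, 0 < e & [set y | d x y < e] `<=` U].

Section Frechet.
Context (R : realType).

(* normc is the modulus of a complex number, as an element of R. *)
Definition seminorm (V : lmodType R[i]) (p : V -> R) : Prop :=
  [/\ forall x, 0 <= p x,
      forall x y, p (x + y) <= p x + p y &
      forall (a : R[i]) x, p (a *: x) = ComplexField.Normc.normc a * p x].

Definition submultiplicative (A : algType R[i]) (p : A -> R) : Prop :=
  forall x y, p (x * y) <= p x * p y.

(* For an increasing sequence p the balls of the single seminorms p n form a
   base of the generated topology: no finite intersections are needed. *)
Definition generated_by (V : lmodType R[i]) (p : nat -> V -> R)
    (tau : topology V) : Prop :=
  forall U : set V, opens tau U <->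
    forall x, U x -> exists n, exists2 e : R, 0 < e &
      [set y | p n (y - x) < e] `<=` U.

Definition frechet_algebra_topology (A : algType R[i]) (tau : topology A) :
    Prop :=
  [/\ locally_convex_topology tau,
      metrizable R tau,
      complete_topology tau &
      exists p : nat -> A -> R,
        [/\ forall n, seminorm (p n),
            forall n, submultiplicative (p n),
            forall n x, p n x <= p n.+1 x &
            generated_by p tau]].

End Frechet.

(* Main.v *)
Require Import Defs.
From HB Require Import structures.
From mathcomp Require Import all_boot all_order all_algebra.
From mathcomp Require Import finmap complex.
From mathcomp Require Import monalg.
From mathcomp Require Import all_classical all_reals all_analysis.
From mathcomp Require Import ring lra.

Set Implicit Arguments.
Unset Strict Implicit.
Unset Printing Implicit Defensive.

Import Order.TTheory GRing.Theory Num.Theory.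
Import numFieldTopology.Exports.
Local Open Scope classical_set_scope.
Local Open Scope ring_scope.

Local Notation normc := ComplexField.Normc.normc.

(** Let [F] be the algebra of power series in [X_0, X_1, ...], with its
    coordinatewise Frechet topology.  Pulling this topology back along an
    algebra automorphism of [F] gives again a Frechet algebra topology, and a
    different one as soon as the automorphism is discontinuous.  So it is
    enough to find a one-parameter group of automorphisms [theta t], all of
    them discontinuous for [t <> 0].

    Choose, by Zorn's lemma, a linear functional [xi] on the space of all
    scalar sequences that vanishes on the finitely supported ones and takes
    the value 1 at the constant sequence 1 ([exists_functional]).  The
    derivative in the direction [xi] is defined by letting [xi] act, one
    coefficient at a time, on the sequence of partial derivatives of [f].  It
    is a derivation [D], because the Leibniz rule for each coefficient of
    [pderiv i (f * g)] is a finite sum whose shape does not depend on [i]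
    ([gderivM]).  It kills every [X_i], yet [D s = 1] for the infinite sum
    [s = X_0 + X_1 + ...].

    The derivation [E = X_0 * D] raises the order in [X_0], so that
    [theta t = exp (t E)] makes sense one coefficient at a time and is a
    one-parameter group of algebra automorphisms ([exp_derivM],
    [exp_derivD]).  It fixes every [X_i], whereas
    [theta t s = s + t X_0] ([exists_flow]).

    Hence the finite sums [X_0 + ... + X_(k-1)] converge to [s - n X_0] in the
    topology pulled back along [theta n]: the limits are distinct, and so are
    the topologies ([exists_frechet_families]).  On the direct sum the
    seminorms [p x + p m] give, for each of these topologies, the product
    topology, from which the first one is recovered. *)

(** * Linear functionals with prescribed kernel *)

Definition linear_subspace (K : fieldType) (V : lmodType K) (W : set V) : Prop :=
  W 0 /\ forall a x y, W x -> W y -> W (a *: x + y).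

Section Functional.
Context (K : fieldType) (V : lmodType K).
Implicit Types (U W : set V) (v x : V).

Lemma linear_subspaceZ U a x : linear_subspace U -> U x -> U (a *: x).
Proof. by move=> [U0 UD] Ux; rewrite -[_ *: _]addr0; apply: UD. Qed.

(** A subspace containing [W] that is maximal among those missing [v] is a
    hyperplane complementary to [v]. *)
Lemma subspace_hyperplane W v : linear_subspace W -> ~ W v ->
  exists2 U, W `<=` U & [/\ linear_subspace U, ~ U v &
    forall x, exists c, U (x - c *: v)].
Proof.
move=> [W0 WD] Wv.
(* The union with [W] makes the empty chain harmless in Zorn's lemma. *)
pose P (A : set V) := linear_subspace (W `|` A) /\ ~ A v.
have [F FP totF|A [[sU Av] maxA]] := @Zorn_bigcup V P.
  split; last by move=> [X FX Xv]; have [] := FP X FX.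
  split; first by left.
  suff H X Y a x y : F X -> F Y -> (W `|` X) x -> (W `|` Y) y ->
      (W `|` \bigcup_(X in F) X) (a *: x + y).
    move=> a x y [Wx|[X FX Xx]] [Wy|[Y FY Yy]].
    - by left; apply: WD.
    - by apply: (H Y Y) => //; [left|right].
    - by apply: (H X X) => //; [right|left].
    - by apply: (H X Y) => //; right.
  move=> FX FY Xx Yy.
  suff [Z FZ [Zx Zy]] : exists2 Z, F Z & (W `|` Z) x /\ (W `|` Z) y.
    have [[_ /(_ a _ _ Zx Zy) [Wxy|Zxy]] _] := FP Z FZ; first by left.
    by right; exists Z.
  have [XY|YX] := totF _ _ FX FY; [exists Y|exists X] => //; split=> //.
    by case: Xx => [Wx|/XY Yx]; [left|right].
  by case: Yy => [Wy|/YX Xy']; [left|right].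
exists (W `|` A); first by move=> x Wx; left.
split=> //; first by case.
set U := W `|` A in sU *; have Uv : ~ U v by case.
move=> x; apply: contrapT => /forallNP Ux.
(* Otherwise the span of [U] and [x] would be larger and still miss [v]. *)
pose U' := [set y | exists c, U (y - c *: x)].
have UU' y : U y -> U' y by exists 0; rewrite scale0r subr0.
have sU' : linear_subspace U'.
  split; first by apply/UU'/sU.1.
  move=> a y z [c Uc] [d Ud]; exists (a * c + d).
  have := sU.2 a _ _ Uc Ud; congr U.
  by rewrite scalerBr scalerDl -scalerA opprD addrACA.
apply: (maxA U'); last first.
  split; first by rewrite (setUidr _)// => y Wy; apply: UU'; left.
  move=> [c Uc]; have [c0|c0] := eqVneq c 0.
    by move: Uc; rewrite c0 scale0r subr0.
  apply: (Ux c^-1); have := linear_subspaceZ (- c^-1) sU Uc; congr U.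
  by rewrite scalerBr scalerA mulNr mulVf// scaleN1r opprK addrC scaleNr.
split; first by move=> y Ay; apply: UU'; right.
move=> /(_ x) H; apply: (Ux 0); rewrite scale0r subr0; right; apply: H.
by exists 1; rewrite scale1r subrr; apply: sU.1.
Qed.

Lemma separating_functional W v : linear_subspace W -> ~ W v ->
  exists phi : V -> K,
    [/\ forall a x y, phi (a *: x + y) = a * phi x + phi y,
        forall w, W w -> phi w = 0 & phi v = 1].
Proof.
move=> sW /(subspace_hyperplane sW)[U WU [sU Uv /choice[phi phiP]]].
have phiE x c : U (x - c *: v) -> phi x = c.
  move=> Uc; apply/eqP/negPn/negP; rewrite -subr_eq0 => d0; apply: Uv.
  have := linear_subspaceZ (phi x - c)^-1 sU (sU.2 (-1) _ _ (phiP x) Uc).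
  congr U; rewrite scaleN1r opprB addrA subrK.
  by rewrite -scalerBl scalerA mulVf// scale1r.
exists phi; split=> [a x y|w Ww|].
- apply: phiE; have := sU.2 a _ _ (phiP x) (phiP y); congr U.
  by rewrite scalerBr scalerDl -scalerA opprD addrACA.
- by apply: phiE; rewrite scale0r subr0; apply: WU.
- by apply: phiE; rewrite scale1r subrr; apply: sU.1.
Qed.

End Functional.

(** * Partial derivatives and derivatives in a generalised direction *)

Section Derivation.
Context (I : choiceType) (K : comNzRingType).
Implicit Types (f g : fps I K) (a b c d m : {cmonom I}) (i j : I).

Lemma fps_coefM f g m : (f * g) m =
  \sum_(bc \in [set bc | mmul bc.1 bc.2 = m]) f bc.1 * g bc.2.
Proof. by []. Qed.

Lemma fps_coef1 m : (1 : fps I K) m = (m == mone)%:R. Proof. by []. Qed.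
Lemma fps_coefD f g m : (f + g) m = f m + g m. Proof. by []. Qed.
Lemma fps_coefB f g m : (f - g) m = f m - g m. Proof. by []. Qed.
Lemma fps_coefZ (k : K) f m : (k *: f) m = k * f m. Proof. by []. Qed.

Lemma mulmI c : injective (mmul^~ c : {cmonom I} -> {cmonom I}).
Proof.
move=> a b /eqP/cmP abc; apply/eqP/cmP => i.
by have := abc i; rewrite !cmM => /addIn.
Qed.

Lemma cm_dvdP d m : (exists c, mmul d c = m) <-> forall i, (d i <= m i)%N.
Proof.
split=> [[c <-] i|dm]; first by rewrite cmM leq_addr.
exists (divcm m d); apply/eqP/cmP => i; rewrite cmM /divcm cmE /= fsfun_fun.
case: ifPn => [_|]; first by rewrite subnKC.
by rewrite -cmE_eq0 => /eqP mi; have := dm i; rewrite mi leqn0 => /eqP ->.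
Qed.

Lemma cm_splitU m i : m i != 0%N -> exists b, m = mmul b (ucm i).
Proof.
move=> mi; have [|b <-] := (cm_dvdP (ucm i) m).2;
  last by exists b; rewrite mulmC.
by move=> j; rewrite cmU; case: (i =P j) => // <-; rewrite lt0n.
Qed.

Definition pderiv i f : fps I K :=
  FPS (fun m => (m i).+1%:R * f (mmul m (ucm i))).

Lemma fps_coef_pderiv i f m :
  pderiv i f m = (m i).+1%:R * f (mmul m (ucm i)).
Proof. by []. Qed.

(** The operator [X_i * d/dX_i], diagonal on monomials: the Leibniz rule is
    obvious for it, and passes to [pderiv i] by a shift of indices. *)
Definition euler i f : fps I K := FPS (fun m => (m i)%:R * f m).

Lemma eulerM i f g : euler i (f * g) = euler i f * g + f * euler i g.
Proof.
apply: fpsP => m; rewrite fps_coefD; transitivity ((m i)%:R * (f * g) m) => //.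
have fin := finite_factorisations m.
rewrite !fps_coefM -fsbig_split// fsbig_distrr//.
apply: eq_fsbigr => -[b c] /set_mem /= bcm.
by rewrite -bcm cmM natrD mulrDl mulrA (mulrCA (f b)).
Qed.

Lemma pderivE i f m : pderiv i f m = euler i f (mmul m (ucm i)).
Proof. by rewrite /= cmM cmUU addn1. Qed.

Lemma coef_pderiv_mul i f g m :
  (pderiv i f * g) m = (euler i f * g) (mmul m (ucm i)).
Proof.
rewrite !fps_coefM.
pose h (bc : {cmonom I} * {cmonom I}) := (mmul bc.1 (ucm i), bc.2).
have hinj : {in [set bc | mmul bc.1 bc.2 = m] &, injective h}.
  by move=> [b c] [b' c'] _ _ [/mulmI -> ->].
rewrite -[RHS](fsbig_widen (h @` [set bc | mmul bc.1 bc.2 = m])).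
- by rewrite fsbig_image//; apply: eq_fsbigr => bc _; rewrite /= cmM cmUU addn1.
- by move=> _ [[b c] /= <- <-] /=; rewrite -!mulmA (mulmC c).
(* The factorisations missed by the shift have no [X_i] in their first factor,
   hence weight 0. *)
move=> [b c] [/= bcm nim].
have [->|/cm_splitU[b' b'E]] := eqVneq (b i) 0%N; first by rewrite !mul0r.
case: nim; exists (b', c); rewrite /h /= ?b'E//.
by apply: (@mulmI (ucm i)); rewrite -bcm b'E -!mulmA (mulmC c).
Qed.

Lemma pderivM i f g : pderiv i (f * g) = pderiv i f * g + f * pderiv i g.
Proof.
apply: fpsP => m; rewrite pderivE eulerM !fps_coefD coef_pderiv_mul.
by congr (_ + _); rewrite mulrC -coef_pderiv_mul mulrC.
Qed.

Section GenericDirection.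
Variable xi : (I -> K^o) -> K.
Hypothesis xiP : forall (k : K) u v, xi (k *: u + v) = k * xi u + xi v.

(** For [xi] a finite combination of the coordinates, this is the usual
    directional derivative; an arbitrary linear [xi] is allowed, and the
    outcome may then be discontinuous. *)
Definition gderiv f : fps I K := FPS (fun m => xi (fun i => pderiv i f m)).

Let xiD u v : xi (fun i => u i + v i) = xi u + xi v.
Proof. by have := xiP 1 u v; rewrite mul1r scale1r. Qed.

Let xi0 : xi (fun=> 0) = 0.
Proof.
have /eqP := xiD (fun=> 0) (fun=> 0).
by rewrite addr0 addrC -subr_eq subrr => /eqP.
Qed.

Let xiZ (k : K) u : xi (fun i => k * u i) = k * xi u.
Proof.
by rewrite -[RHS]addr0 -xi0 -xiP; congr xi; apply/funext => i; rewrite addr0.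
Qed.

Let xi_sum (T : Type) (r : seq T) (F : I -> T -> K) :
  xi (fun i => \sum_(t <- r) F i t) = \sum_(t <- r) xi (F^~ t).
Proof.
elim: r => [|t r IH].
  by rewrite big_nil -[RHS]xi0; congr xi; apply/funext => i; rewrite big_nil.
by rewrite big_cons -IH -xiD; congr xi; apply/funext => i; rewrite big_cons.
Qed.

Let xi_fsum (T : choiceType) (P : set T) (F : I -> T -> K) : finite_set P ->
  xi (fun i => \sum_(t \in P) F i t) = \sum_(t \in P) xi (F^~ t).
Proof.
move=> fP; rewrite fsbig_finite// -xi_sum.
by congr xi; apply/funext => i; rewrite fsbig_finite.
Qed.

Lemma gderiv_linear (k : K) f g :
  gderiv (k *: f + g) = k *: gderiv f + gderiv g.
Proof.
apply: fpsP => m; rewrite fps_coefD fps_coefZ /= -xiP; congr xi.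
by apply/funext => i; rewrite /= mulrDr mulrCA.
Qed.

(** Each coefficient of [pderiv i (f * g)] is a sum over factorisations of a
    monomial that does not depend on [i], so [xi] can be applied termwise. *)
Lemma gderivM f g : gderiv (f * g) = gderiv f * g + f * gderiv g.
Proof.
apply: fpsP => m; have fin := finite_factorisations m.
rewrite fps_coefD !fps_coefM -fsbig_split//.
transitivity (xi (fun i => \sum_(bc \in [set bc | mmul bc.1 bc.2 = m])
    (pderiv i f bc.1 * g bc.2 + f bc.1 * pderiv i g bc.2))).
  congr xi; apply/funext => i.
  by rewrite pderivM fps_coefD !fps_coefM -fsbig_split.
rewrite xi_fsum//; apply: eq_fsbigr => -[b c] _ /=.
rewrite xiD; congr (_ + _); last by rewrite -xiZ.
by rewrite mulrC -xiZ; congr xi; apply/funext => i; rewrite mulrC.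
Qed.

End GenericDirection.
End Derivation.

(** * The exponential of a derivation that raises the order *)

(** The binomial formula behind the iterated Leibniz rule, with
    [T i j = E^i f * E^j g] in mind. *)
Lemma iter_binomial (V : zmodType) (E : {additive V -> V}) (T : nat -> nat -> V)
    n : (forall i j, E (T i j) = T i.+1 j + T i j.+1) ->
  iter n E (T 0 0) = \sum_(i < n.+1) T i (n - i)%N *+ 'C(n, i).
Proof.
move=> ET; elim: n => [|n IH]; first by rewrite big_ord_recl big_ord0 addr0.
rewrite iterS IH raddf_sum /=.
transitivity (\sum_(i < n.+1) (T i.+1 (n - i)%N *+ 'C(n, i) +
    T i (n.+1 - i)%N *+ 'C(n, i))).
  by apply: eq_bigr => i _; rewrite raddfMn /= ET mulrnDl subSn// -ltnS.
rewrite big_split /= addrC big_ord_recl [in RHS]big_ord_recl/= !bin0 -addrA.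
congr (_ + _); rewrite big_ord_recr /= [in RHS]big_ord_recr /= !binn addrA.
congr (_ + _); rewrite -big_split /=; apply: eq_bigr => i _.
by rewrite /bump !add1n binS mulrnDr.
Qed.

Lemma sum_triangle (V : nmodType) (b : nat -> nat -> V) N :
  \sum_(0 <= n < N) \sum_(0 <= i < n.+1) b i (n - i)%N =
  \sum_(0 <= i < N) \sum_(0 <= j < N - i) b i j.
Proof.
elim: N => [|N IH]; first by rewrite !big_nil.
rewrite !big_nat_recr//= IH subSn// subnn big_nat1 addrA -big_split /=.
congr (_ + _); apply: eq_big_nat => i /andP[_ iN].
by rewrite subSn ?big_nat_recr// ltnW.
Qed.

Section Exponential.
Context (I : choiceType) (K : numFieldType) (i0 : I).
Implicit Types (f g h : fps I K) (m : {cmonom I}) (s t : K) (n N : nat).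

(** The ideal of the series divisible by [X_i0 ^ N], described by coefficients
    so that no quotient has to be exhibited. *)
Definition vanish N f := forall m, (m i0 < N)%N -> f m = 0.

Lemma vanishW N N' f : (N' <= N)%N -> vanish N f -> vanish N' f.
Proof. by move=> NN fN m mN; apply: fN; apply: leq_trans NN. Qed.

Lemma vanishD N f g : vanish N f -> vanish N g -> vanish N (f + g).
Proof. by move=> fN gN m mN; rewrite fps_coefD fN// gN// addr0. Qed.

Lemma vanishZ N t f : vanish N f -> vanish N (t *: f).
Proof. by move=> fN m mN; rewrite fps_coefZ fN// mulr0. Qed.

Lemma vanishBC N f g : vanish N (f - g) -> vanish N (g - f).
Proof. by move=> fg m /fg mN; rewrite -opprB -scaleN1r fps_coefZ mN mulr0. Qed.

Lemma vanish_trans N g f h : vanish N (f - g) -> vanish N (g - h) ->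
  vanish N (f - h).
Proof. by move=> fg gh; rewrite -(subrK g f) -addrA; apply: vanishD. Qed.

Lemma vanish_sum N (T : eqType) (r : seq T) (F : T -> fps I K) :
  (forall x, x \in r -> vanish N (F x)) -> vanish N (\sum_(x <- r) F x).
Proof.
move=> FN; rewrite big_seq; apply: (big_ind (vanish N)) => //.
by move=> f g; apply: vanishD.
Qed.

Lemma vanishM i j f g : vanish i f -> vanish j g -> vanish (i + j) (f * g).
Proof.
move=> fi gj m mij; rewrite fps_coefM fsbig1// => -[b c] /= bcm.
have [/fi->|ib] := ltnP (b i0) i; first by rewrite mul0r.
rewrite gj ?mulr0//; have := mij; rewrite -bcm cmM => bcij.
by rewrite -(ltn_add2l i) (leq_ltn_trans _ bcij)// leq_add2r.
Qed.

Lemma vanish_eq f g : (forall N, vanish N (f - g)) -> f = g.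
Proof.
move=> fg; apply: fpsP => m.
by apply/eqP; rewrite -subr_eq0 -fps_coefB (fg (m i0).+1).
Qed.

(** The Cauchy product of two truncated exponentials, up to terms of high
    order; it serves both for multiplicativity and for the group law. *)
Lemma vanish_square_triangle (b : nat -> nat -> fps I K) N :
    (forall i j, vanish (i + j) (b i j)) ->
  vanish N (\sum_(0 <= i < N) \sum_(0 <= j < N) b i j -
            \sum_(0 <= n < N) \sum_(0 <= i < n.+1) b i (n - i)%N).
Proof.
move=> bN; rewrite sum_triangle -sumrB; apply: vanish_sum => i _.
rewrite (big_cat_nat (n := (N - i)%N)) ?leq_subr//= [X in X - _]addrC addrK.
apply: vanish_sum => j; rewrite mem_index_iota => /andP[Nij _].
by apply: vanishW (bN i j); rewrite -leq_subLR.
Qed.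

Variable E : fps I K -> fps I K.
Hypothesis E_linear : linear E.
Hypothesis EM : forall f g, E (f * g) = E f * g + f * E g.
Hypothesis E_vanish : forall N f, vanish N f -> vanish N.+1 (E f).

HB.instance Definition _ := GRing.isLinear.Build K _ _ _ E E_linear.

Definition exp_trunc N t f := \sum_(0 <= n < N) (t ^+ n / n`!%:R) *: iter n E f.

(** The exponential series of [t E].  The coefficient at [m] receives nothing
    from the terms of index greater than [m i0]. *)
Definition exp_deriv t f : fps I K := FPS (fun m => exp_trunc (m i0).+1 t f m).

Lemma vanish_iter n f : vanish n (iter n E f).
Proof. by elim: n => [//|n IH]; apply: E_vanish. Qed.

Lemma iterE_linear n : linear (iter n E).
Proof. by elim: n => [//|n IH] t f g /=; rewrite IH linearP. Qed.

Lemma exp_derivP N t f : vanish N (exp_deriv t f - exp_trunc N t f).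
Proof.
move=> m mN; rewrite fps_coefB; apply/eqP; rewrite subr_eq0 eq_sym; apply/eqP.
rewrite {1}/exp_trunc (big_cat_nat (n := (m i0).+1))// fps_coefD.
rewrite [X in _ + X](_ : _ = 0) ?addr0//.
apply: (@vanish_sum (m i0).+1) => // n; rewrite mem_index_iota => /andP[mn _].
exact/vanishZ/(vanishW mn)/vanish_iter.
Qed.

Lemma exp_trunc_linear N t : linear (exp_trunc N t).
Proof.
move=> k f g; rewrite /exp_trunc scaler_sumr -big_split /=.
apply: eq_bigr => n _.
by rewrite iterE_linear scalerDr !scalerA (mulrC k).
Qed.

Lemma exp_deriv_linear t : linear (exp_deriv t).
Proof. by move=> k f g; apply: fpsP => m; rewrite /= exp_trunc_linear. Qed.

Lemma iterEM n f g : iter n E (f * g) =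
  \sum_(i < n.+1) (iter i E f * iter (n - i) E g) *+ 'C(n, i).
Proof.
by apply: (@iter_binomial _ E (fun i j => iter i E f * iter j E g))
  => i j; exact: EM.
Qed.

Lemma inv_fact_bin n i : (i <= n)%N ->
  (n`!%:R)^-1 * 'C(n, i)%:R = (i`!%:R)^-1 * ((n - i)`!%:R)^-1 :> K.
Proof.
move=> le_in; have fact_neq0 k : (k`!)%:R != 0 :> K.
  by rewrite pnatr_eq0 -lt0n fact_gt0.
rewrite -(bin_fact le_in) !natrM; field.
by rewrite !fact_neq0 pnatr_eq0 -lt0n bin_gt0.
Qed.

(** Modulo each power of [X_i0], both sides are the same truncated double
    sum. *)
Lemma exp_derivM t f g : exp_deriv t (f * g) = exp_deriv t f * exp_deriv t g.
Proof.
apply: vanish_eq => N.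
pose b i j :=
  ((t ^+ i / i`!%:R) *: iter i E f) * ((t ^+ j / j`!%:R) *: iter j E g).
have bN i j : vanish (i + j) (b i j).
  by apply: vanishM; apply/vanishZ/vanish_iter.
apply: (vanish_trans (exp_derivP _ _)).
have -> : exp_trunc N t (f * g) =
    \sum_(0 <= n < N) \sum_(0 <= i < n.+1) b i (n - i)%N.
  apply: eq_bigr => n _; rewrite iterEM scaler_sumr big_mkord.
  apply: eq_bigr => -[i /= ilen] _.
  rewrite /b -scalerAl -scalerAr scalerA -scaler_nat scalerA; congr (_ *: _).
  by rewrite -mulrA inv_fact_bin// mulrACA -exprD subnKC.
apply: (vanish_trans (vanishBC (vanish_square_triangle bN))).
have -> : \sum_(0 <= i < N) \sum_(0 <= j < N) b i j =
    exp_trunc N t f * exp_trunc N t g.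
  rewrite /exp_trunc mulr_suml; apply: eq_bigr => i _.
  by rewrite mulr_sumr.
apply: vanishBC.
rewrite -(subrK (exp_trunc N t f * exp_deriv t g) (_ * _)) -addrA.
rewrite -mulrBl -mulrBr; apply: vanishD.
  by rewrite -[N]addn0; apply: vanishM => //; rewrite addn0; apply: exp_derivP.
by rewrite -[N]add0n; apply: vanishM => //; rewrite add0n; apply: exp_derivP.
Qed.

Lemma exp_deriv_comm t f : E (exp_deriv t f) = exp_deriv t (E f).
Proof.
apply: vanish_eq => N.
apply: (vanish_trans _ (vanishBC (exp_derivP t (E f)))).
have -> : exp_trunc N t (E f) = E (exp_trunc N t f).
  rewrite linear_sum; apply: eq_bigr => n _.
  by rewrite linearZ/= -iterSr.
rewrite -linearB; apply/(vanishW (leqnSn N))/E_vanish/exp_derivP.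
Qed.

(** [E] commutes with [exp (t E)], so that modulo each power of [X_i0] the
    left-hand side is again a truncated double sum. *)
Lemma exp_derivD s t f : exp_deriv s (exp_deriv t f) = exp_deriv (s + t) f.
Proof.
apply: vanish_eq => N.
pose b i j := (s ^+ i / i`!%:R * (t ^+ j / j`!%:R)) *: iter (i + j) E f.
have bN i j : vanish (i + j) (b i j) by apply/vanishZ/vanish_iter.
apply: (vanish_trans (exp_derivP _ _)).
apply: (vanish_trans _ (vanishBC (exp_derivP _ _))).
have -> : exp_trunc N (s + t) f =
    \sum_(0 <= n < N) \sum_(0 <= i < n.+1) b i (n - i)%N.
  apply: eq_bigr => n _; rewrite big_mkord addrC exprDn mulr_suml scaler_suml.
  apply: eq_bigr => -[i /= ilen] _; rewrite /b subnKC//; congr (_ *: _).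
  rewrite -(mulr_natr _ 'C(n, i)).
  by rewrite -[LHS]mulrA (mulrC 'C(n, i)%:R) inv_fact_bin//
    (mulrC (t ^+ _)) mulrACA.
apply: (vanish_trans _ (vanish_square_triangle bN)).
rewrite -sumrB; apply: vanish_sum => i _.
have -> : iter i E (exp_deriv t f) = exp_deriv t (iter i E f).
  by elim: i => //= i ->; rewrite exp_deriv_comm.
have -> : \sum_(0 <= j < N) b i j =
    (s ^+ i / i`!%:R) *: exp_trunc N t (iter i E f).
  rewrite scaler_sumr; apply: eq_bigr => j _.
  by rewrite scalerA /b addnC iterD.
by rewrite -scalerBr; apply/vanishZ/exp_derivP.
Qed.

Lemma exp_deriv0 f : exp_deriv 0 f = f.
Proof.
apply: fpsP => m; transitivity (exp_trunc (m i0).+1 0 f m) => //.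
rewrite /exp_trunc big_nat_recl// big1 ?addr0.
  by rewrite expr0 fact0 divr1 scale1r.
by move=> n _; rewrite expr0n mul0r scale0r.
Qed.

Lemma exp_deriv_fix t f : E f = 0 -> exp_deriv t f = f.
Proof.
move=> Ef; apply: fpsP => m; transitivity (exp_trunc (m i0).+1 t f m) => //.
rewrite /exp_trunc big_nat_recl// big1 ?addr0.
  by rewrite expr0 fact0 divr1 scale1r.
move=> n _; suff -> : iter n.+1 E f = 0 by rewrite scaler0.
by elim: n => [//|n IH]; rewrite iterS IH linear0.
Qed.

Lemma exp_deriv_trunc2 t f : E (E f) = 0 -> exp_deriv t f = f + t *: E f.
Proof.
move=> EEf; apply: vanish_eq => N; apply: (@vanishW N.+2).
  by rewrite -addn2 leq_addr.
suff <- : exp_trunc N.+2 t f = f + t *: E f by exact: exp_derivP.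
rewrite /exp_trunc big_nat_recl// big_nat_recl// big1 ?addr0.
  by rewrite expr0 fact0 divr1 scale1r expr1 divr1.
move=> n _; suff -> : iter n.+2 E f = 0 by rewrite scaler0.
by elim: n => [//|n IH]; rewrite iterS IH linear0.
Qed.

End Exponential.

(** * A discontinuous one-parameter group of automorphisms *)

Section LinearForms.
Context (I : choiceType) (K : comNzRingType).
Implicit Types (u v : I -> K) (m : {cmonom I}) (i j : I).

(** The possibly infinite linear form with coefficients [u]: at most one term
    of the sum is nonzero, and only when [m] is a single indeterminate. *)
Definition linform u : fps I K :=
  FPS (fun m => \sum_(i <- finsupp m) (m == ucm i)%:R * u i).

Lemma linformU u i : linform u (ucm i) = u i.
Proof. by rewrite /= mdomU big_seq_fset1 eqxx mul1r. Qed.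

Lemma linform_notU u m : (forall i, m = ucm i -> u i = 0) -> linform u m = 0.
Proof.
move=> mU; rewrite /= big1// => i _; case: eqP => [/mU ->|]; rewrite ?mulr0//.
by rewrite mul0r.
Qed.

Lemma mulm_eqU m i j : mmul m (ucm i) = ucm j -> m = mone.
Proof.
move=> mij; have /eqP/cmP mijE := mij.
have ji : j = i.
  by have := mijE i; rewrite cmM !cmU eqxx addn1; case: eqP.
by apply: (@mulmI I (ucm i)); rewrite mij ji mul1m.
Qed.

Lemma pderiv_linform i u : pderiv i (linform u) = u i *: 1.
Proof.
apply: fpsP => m; rewrite fps_coefZ fps_coef1 fps_coef_pderiv.
have [->|m1] := eqVneq m mone.
  by rewrite mul1m linformU cm1 mul1r mulr1.
rewrite mulr0 linform_notU ?mulr0// => j /mulm_eqU m1E.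
by rewrite m1E eqxx in m1.
Qed.

End LinearForms.

(** Such a functional is an algebraic analogue of a limit at infinity, but one
    defined on unbounded sequences too. *)
Lemma exists_functional (K : fieldType) : exists xi : (nat -> K^o) -> K,
  [/\ forall (k : K) u v, xi (k *: u + v) = k * xi u + xi v,
      forall u n, (forall i, (n <= i)%N -> u i = 0) -> xi u = 0 &
      xi (fun=> 1) = 1].
Proof.
pose W (u : nat -> K^o) := exists n, forall i, (n <= i)%N -> u i = 0.
have sW : linear_subspace W.
  split; first by exists 0%N.
  move=> a u v [n un] [p vp].
  exists (maxn n p) => i; rewrite geq_max => /andP[ni pi].
  by rewrite [LHS](_ : _ = a * u i + v i)// un// vp// mulr0 addr0.
have W1 : ~ W (fun=> 1).
  by rewrite /W => - [n /(_ n (leqnn n))]/eqP; rewrite oner_eq0.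
have [xi [xiP xiW xi1]] := separating_functional sW W1.
by exists xi; split => // u n un; apply: xiW; exists n.
Qed.

(** The flow of the derivation [X_0 * D], where [D] is the derivative in the
    direction of the functional above.  It fixes finite linear forms but moves
    the sum of all indeterminates. *)
Lemma exists_flow (K : numFieldType) : 
  exists theta : K -> fps nat K -> fps nat K,
  [/\ [/\ forall t, linear (theta t),
      forall t f g, theta t (f * g) = theta t f * theta t g,
      forall s t f, theta s (theta t f) = theta (s + t) f &
      forall f, theta 0 f = f],
      forall t u n, (forall i, (n <= i)%N -> u i = 0) ->
        theta t (linform u) = linform u &
      forall t, theta t (linform (fun=> 1)) =
        linform (fun=> 1) + t *: linform (fun i => (i == 0)%:R)].
Proof.
have [xi [xi_lin xi_fin xi1]] := exists_functional K.
pose D := gderiv xi; pose X0 : fps nat K := linform (fun i => (i == 0)%:R).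
have D_linear k f g : D (k *: f + g) = k *: D f + D g by exact: gderiv_linear.
have DM f g : D (f * g) = D f * g + f * D g by exact: gderivM.
pose E f := X0 * D f.
have D_linform u : D (linform u) = xi u *: 1.
  apply: fpsP => m; rewrite fps_coefZ mulrC.
  transitivity (xi (fun i => (1 : fps nat K) m * u i)).
    by congr xi; apply/funext => i; rewrite pderiv_linform fps_coefZ mulrC.
  rewrite -[RHS]addr0 -(xi_fin (fun=> 0) 0%N)// -xi_lin; congr xi.
  by apply/funext => i; rewrite /= addr0.
have E_linear : linear E.
  by move=> k f g; rewrite /E D_linear mulrDr scalerAr.
have EM f g : E (f * g) = E f * g + f * E g.
  by rewrite /E DM mulrDr mulrA (mulrCA X0 f).
(* [D] does not lower the order in [X_0]: below that order only the partial
   derivative of index 0 can contribute, and [xi] ignores a single entry. *)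
have E_vanish N f : vanish 0%N N f -> vanish 0%N N.+1 (E f).
  move=> fN; rewrite -add1n; apply: vanishM.
    move=> m m0; apply: linform_notU => i mi; move: m0; rewrite mi cmU.
    by case: eqP.
  move=> m mN; apply: (xi_fin _ 1%N) => i i0.
  rewrite /= fN ?mulr0// cmM cmU; case: eqP i0 => [->//|_ _].
  by rewrite addn0.
have E_fin u n : (forall i, (n <= i)%N -> u i = 0) -> E (linform u) = 0.
  by move=> un; rewrite /E D_linform (xi_fin _ n)// scale0r mulr0.
exists (exp_deriv 0%N E); split=> [|t u n un|t].
- split.
  + exact: exp_deriv_linear.
  + exact: exp_derivM.
  + exact: exp_derivD.
  + exact: exp_deriv0.
- by apply: exp_deriv_fix => //; apply: E_fin un.
- have E1 : E (linform (fun=> 1)) = X0.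
    by rewrite /E D_linform xi1 scale1r mulr1.
  rewrite (exp_deriv_trunc2 E_linear) ?E1//.
  by apply: (E_fin _ 1%N) => -[].
Qed.

(** * Frechet topologies from families of seminorms *)

Section ComplexModulus.
Context (R : rcfType).
Implicit Types (a b : R[i]) (r : R).

Lemma normc_ge0 a : 0 <= normc a.
Proof. by case: a => x y; rewrite /= sqrtr_ge0. Qed.

Lemma normr_normc a : `|a| = ((normc a)%:C)%C.
Proof. by case: a. Qed.

Lemma normcR r : normc (r%:C)%C = `|r|.
Proof. by rewrite /= expr0n addr0 sqrtr_sqr. Qed.

End ComplexModulus.

Section FrechetFamily.
Context (R : realType).

(** Completeness is stated in terms of the seminorms alone, so that it can be
    checked before any topology is available. *)
Record frechet_family (A : algType R[i]) := FrechetFamily {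
  fam :> nat -> A -> R ;
  fam_seminorm : forall n, seminorm (fam n) ;
  fam_submul : forall n, submultiplicative (fam n) ;
  fam_incr : forall n x, fam n x <= fam n.+1 x ;
  fam_separated : forall x, (forall n, fam n x = 0) -> x = 0 ;
  fam_complete : forall F : set_system A, ProperFilter F ->
    (forall n (e : R), 0 < e ->
       exists2 B, F B & forall x y, B x -> B y -> fam n (x - y) < e) ->
    exists x, forall n (e : R), 0 < e -> F [set y | fam n (y - x) < e]
}.

Context (A : algType R[i]) (p : frechet_family A).
Implicit Types (x y z : A) (U : set A) (n : nat) (a : R[i]) (e : R).

Lemma fam_ge0 n x : 0 <= p n x.
Proof. by have [] := fam_seminorm p n. Qed.

Lemma famD n x y : p n (x + y) <= p n x + p n y.
Proof. by have [] := fam_seminorm p n. Qed.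

Lemma famZ n a x : p n (a *: x) = normc a * p n x.
Proof. by have [] := fam_seminorm p n. Qed.

Lemma fam0 n : p n 0 = 0.
Proof. by rewrite -(scale0r 0) famZ ComplexField.Normc.normc0 mul0r. Qed.

Lemma famN n x : p n (- x) = p n x.
Proof.
by rewrite -scaleN1r famZ normcN ComplexField.Normc.normc1 mul1r.
Qed.

Lemma famC n x y : p n (x - y) = p n (y - x).
Proof. by rewrite -famN opprB. Qed.

Lemma fam_triangle n y x z : p n (x - z) <= p n (x - y) + p n (y - z).
Proof. by rewrite -(subrKA y x (- z)); apply: famD. Qed.

Lemma fam_le m n x : (m <= n)%N -> p m x <= p n x.
Proof.
move=> /subnK <-; elim: (n - m)%N => [//|k IH].
by apply: le_trans IH _; apply: fam_incr.
Qed.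

Definition fam_ball n x e : set A := [set y | p n (y - x) < e].

Lemma fam_ball_center n x e : 0 < e -> fam_ball n x e x.
Proof. by move=> e0; rewrite /fam_ball /= subrr fam0. Qed.

Definition fam_open U := forall x, U x ->
  exists n, exists2 e : R, 0 < e & fam_ball n x e `<=` U.

Lemma fam_openT : fam_open setT.
Proof. by move=> x _; exists 0%N, 1. Qed.

Lemma fam_openI : setI_closed fam_open.
Proof.
move=> U V oU oV x [/oU[n [e e0 eU]] /oV[m [d d0 dV]]].
exists (maxn n m), (Num.min e d); first by rewrite lt_min e0.
move=> y; rewrite /fam_ball /= lt_min => /andP[ye yd]; split.
  by apply: eU; apply: le_lt_trans ye; rewrite fam_le// leq_maxl.
by apply: dV; apply: le_lt_trans yd; rewrite fam_le// leq_maxr.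
Qed.

Lemma fam_open_bigU (I : Type) (F : I -> set A) :
  (forall i, fam_open (F i)) -> fam_open (\bigcup_i F i).
Proof.
move=> oF x [i _ /(oF i)[n [e e0 eF]]]; exists n, e => //.
by move=> y /eF Fy; exists i.
Qed.

Definition fam_topology : topology A :=
  Topology fam_openT fam_openI fam_open_bigU.

Lemma fam_ball_open n x e : fam_open (fam_ball n x e).
Proof.
move=> y; rewrite /fam_ball /= => ye; exists n, (e - p n (y - x)).
  by rewrite subr_gt0.
move=> z; rewrite /fam_ball /= ltrBrDr => zy.
exact: le_lt_trans (fam_triangle n y z x) zy.
Qed.

Local Notation X := (topologized fam_topology).

Lemma nbhs_famP (x : X) (U : set X) :
  nbhs x U <-> exists n, exists2 e : R, 0 < e & fam_ball n x e `<=` U.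
Proof.
split.
  rewrite nbhsE => -[V [oV Vx] VU].
  have [n [e e0 eV]] := oV x Vx; exists n, e => //.
  exact: subset_trans VU.
move=> [n [e e0 eU]]; rewrite nbhsE; exists (fam_ball n x e) => //; split.
  exact: fam_ball_open.
exact: fam_ball_center.
Qed.

Lemma nbhs_fam_ball n (x : X) e : 0 < e -> nbhs x (fam_ball n x e : set X).
Proof. by move=> e0; apply/nbhs_famP; exists n, e. Qed.

Lemma fam_continuousD : continuous (fun z : X * X => z.1 + z.2).
Proof.
move=> [x y] U /= /nbhs_famP[n [e e0 eU]].
have e20 : 0 < e / 2 by rewrite divr_gt0.
exists (fam_ball n x (e / 2), fam_ball n y (e / 2)) => /=.
  by split; apply: nbhs_fam_ball.
move=> [x' y'] [/= xx yy]; apply: eU.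
rewrite /fam_ball /= opprD addrACA (le_lt_trans (famD _ _ _))//.
by rewrite [e]splitr ltrD.
Qed.

Lemma fam_continuousZ : continuous (fun z : (R[i])^o * X => z.1 *: z.2).
Proof.
move=> [a x] U /= /nbhs_famP[n [e e0 eU]].
(* The three terms in the decomposition of [b y - a x] below are at most
   [d * d <= d], [d * p n x] and [d * normc a], with sum [d * c]. *)
pose c := 1 + p n x + normc a.
have c1 : 1 <= c by rewrite /c -addrA lerDl addr_ge0 ?fam_ge0 ?normc_ge0.
have c0 : 0 < c by apply: lt_le_trans c1.
pose d := Num.min 1 (e / (2 * c)).
have d0 : 0 < d by rewrite lt_min ltr01 divr_gt0// mulr_gt0.
exists (ball (a : (R[i])^o) (d%:C)%C, fam_ball n x d) => /=.
  split; last exact: nbhs_fam_ball.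
  by apply: nbhsx_ballx; rewrite ltcR.
move=> [b y] [/= + xy]; rewrite -ball_normE /= distrC normr_normc ltcR => ab.
apply: eU; rewrite /fam_ball /=.
have -> : b *: y - a *: x = (b - a) *: (y - x) + (b - a) *: x + a *: (y - x).
  by rewrite -scalerDr subrK scalerBl scalerBr addrA subrK.
apply: (@le_lt_trans _ _ (d * c)).
  rewrite /c !mulrDr mulr1 (le_trans (famD _ _ _))// famZ lerD//; last first.
    by rewrite mulrC ler_wpM2r ?normc_ge0// ltW.
  rewrite (le_trans (famD _ _ _))// !famZ lerD//; last first.
    by rewrite ler_wpM2r ?fam_ge0// ltW.
  rewrite -[leRHS]mul1r ler_pM ?normc_ge0 ?fam_ge0//; last exact: ltW.
  by apply: ltW; apply: lt_le_trans ab _; rewrite ge_min lexx.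
apply: (@le_lt_trans _ _ (e / 2));
  last by rewrite ltr_pdivrMr// ltr_pMr// ltr1n.
by rewrite -ler_pdivlMr// -mulrA -invfM ge_min lexx orbT.
Qed.

(** The weight [l] lies between 0 and 1 for the order of [R[i]], hence it is a
    real number. *)
Lemma fam_ball_convex n x e : convex_set (fam_ball n x e).
Proof.
move=> y z l /set_mem yx /set_mem zx; apply/mem_set.
change (fam_ball n x e (l%:num *: (y : A) + (1 - l%:num) *: (z : A))).
have : l%:num <= 1 by [].
have : 0 <= l%:num by [].
move: (l%:num) => t t0 t1; pose r := complex.Re t.
have tE : t = (r%:C)%C by rewrite RRe_real// ger0_real.
rewrite /fam_ball /= in yx zx *.
have -> : t *: (y : A) + (1 - t) *: (z : A) - x =
    (r%:C)%C *: (y - x) + ((1 - r)%:C)%C *: (z - x).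
  rewrite [X in X *: (z - x)](_ : _ = 1 - t);
    last by rewrite tE rmorphB rmorph1.
  rewrite -tE !scalerBr addrACA -opprD -scalerDl.
  by rewrite (addrC t) subrK scale1r.
have r0 : 0 <= r by move: t0; rewrite tE lecR.
have r1 : 0 <= 1 - r by move: t1; rewrite tE (_ : 1 = (1%:C)%C)// lecR subr_ge0.
rewrite (le_lt_trans (famD _ _ _))// !famZ !normcR !ger0_norm//.
have -> : e = r * e + (1 - r) * e by rewrite -mulrDl addrC subrK mul1r.
have [r_gt0|] := ltP 0 r.
  by rewrite ltr_leD ?ler_wpM2l ?ltr_pM2l// ltW.
rewrite le_eqVlt ltNge r0 orbF => /eqP ->.
by rewrite !mul0r !add0r subr0 !mul1r.
Qed.

Lemma fam_locally_convex : locally_convex_topology fam_topology.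
Proof.
split; [exact: fam_continuousD|exact: fam_continuousZ|].
exists [set b | exists n x e, b = fam_ball n x e].
  by move=> _ /set_mem[n [x [e ->]]]; apply: fam_ball_convex.
split; first by move=> _ [n [x [e ->]]]; apply: fam_ball_open.
move=> x U /nbhs_famP[n [e e0 eU]]; exists (fam_ball n x e) => //.
by split; [exists n, x, e|apply: fam_ball_center].
Qed.

Lemma fam_complete_topology : complete_topology fam_topology.
Proof.
move=> F PF cF; have [n e e0|x xF] := @fam_complete A p F PF.
  have [[B C] [/= FB FC] BC] := cF _ (nbhs_fam_ball n (0 : X) e0).
  exists (B `&` C); first exact: filterI.
  move=> x y [Bx _] [_ Cy]; have := BC (x, y) (conj Bx Cy).
  by rewrite /fam_ball /= subr0.
exists x => U /nbhs_famP[n [e e0 eU]].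
exact: filterS eU (xF n e e0).
Qed.

(** The metric is the supremum over [n] of the minimum of [1 / (n + 1)] and
    [p n (x - y)]: a distance of at most [1 / (n + 1)] constrains only the first
    [n] seminorms. *)
Let gauge z n := Num.min (n.+1%:R^-1) (p n z).
Let gauge_set z := [set gauge z n | n in setT].
Let dist x y := sup (gauge_set (x - y)).

Let has_sup_gauge z : has_sup (gauge_set z).
Proof.
split; first by exists (gauge z 0%N); exists 0%N.
exists 1 => _ [n _ <-]; rewrite ge_min invf_le1 ?ltr0n// ler1n.
by [].
Qed.

Let gauge_le x y n : gauge (x - y) n <= dist x y.
Proof. by apply: ub_le_sup; [exact: (has_sup_gauge _).2|exists n]. Qed.

Let dist_le x y c : (forall n, gauge (x - y) n <= c) -> dist x y <= c.
Proof.
by move=> gc; apply: ge_sup; [exact: (has_sup_gauge _).1|move=> _ [n _ <-]].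
Qed.

Let gauge_ge0 z n : 0 <= gauge z n.
Proof. by rewrite le_min invr_ge0 ler0n fam_ge0. Qed.

Lemma fam_metrizable : metrizable R fam_topology.
Proof.
exists dist; split=> [x|x y xy0|x y|x y z|U].
- apply/eqP; rewrite eq_le (le_trans (gauge_ge0 _ 0%N) (gauge_le _ _ _)) andbT.
  by apply: dist_le => n; rewrite ge_min subrr fam0 lexx orbT.
- apply/eqP; rewrite -subr_eq0; apply/eqP/(fam_separated (f := p)) => n.
  apply/eqP; have := gauge_le x y n; rewrite xy0 /gauge ge_min.
  by rewrite leNgt invr_gt0 ltr0n /= eq_le fam_ge0 => ->.
- have xyE : gauge (x - y) = gauge (y - x).
    by apply/funext => n; rewrite /gauge famC.
  by rewrite /dist /gauge_set xyE.
- apply: dist_le => n; apply: le_trans (lerD (gauge_le x y n) (gauge_le y z n)).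
  rewrite /gauge; have := fam_triangle n y x z.
  have := fam_ge0 n (x - y); have := fam_ge0 n (y - z).
  have : 0 <= n.+1%:R^-1 :> R by rewrite invr_ge0.
  move: (n.+1%:R^-1) (p n (x - y)) (p n (y - z)) (p n (x - z)) => k a b c.
  by rewrite !minEle; do 3 case: ifPn; lra.
split=> oU x Ux.
  have [n [e e0 eU]] := oU x Ux.
  exists (Num.min (n.+1%:R^-1) e); first by rewrite lt_min e0 invr_gt0 ltr0n.
  move=> y /= xy; apply: eU; rewrite /fam_ball /= famC.
  move: xy; rewrite lt_min => /andP[xyn xye].
  have := le_lt_trans (gauge_le x y n) xyn; rewrite gt_min ltxx /= => yn.
  apply: le_lt_trans xye; apply: le_trans (gauge_le x y n).
  by rewrite le_min lexx andbT ltW.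
have [e e0 eU] := oU x Ux; have e20 : 0 < e / 2 by rewrite divr_gt0.
pose N := Num.trunc (e / 2)^-1.
exists N, (e / 2) => // y yx; apply: eU => /=.
apply: (@le_lt_trans _ _ (e / 2));
  last by rewrite ltr_pdivrMr// ltr_pMr// ltr1n.
apply: dist_le => n; rewrite ge_min; have [nN|Nn] := leqP n N.
  by rewrite famC (le_trans (fam_le _ nN) (ltW yx)) orbT.
rewrite -[e / 2]invrK lef_pV2 ?posrE ?invr_gt0 ?ltr0n//.
apply/orP; left; apply: le_trans (ltW (truncnS_gt _)) _.
by rewrite ler_nat ltnW.
Qed.

Theorem fam_frechet : frechet_algebra_topology fam_topology.
Proof.
split; [exact: fam_locally_convex|exact: fam_metrizable|
  exact: fam_complete_topology|].
exists p; split; [exact: fam_seminorm|exact: fam_submul|exact: fam_incr|by []].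
Qed.

End FrechetFamily.

(** * Seminorms defining the coordinatewise topology *)

Section BoxSeminorms.
Context (R : realType).
Implicit Types (f g : fps nat R[i]) (m d b c : {cmonom nat}) (n N : nat).

(** The monomial [(X_0 ... X_(n-1)) ^ n].  Every monomial divides [box n] for
    large [n]. *)
Definition box n : {cmonom nat} :=
  mkcmonom [fsfun i in [fset x in iota 0 n]%fset => n | 0%N].

Lemma boxE n i : box n i = if (i < n)%N then n else 0%N.
Proof. by rewrite cmE /= fsfun_fun in_fset /= mem_iota. Qed.

Definition box_divisors n : seq {cmonom nat} :=
  fset_set [set d | exists c, mmul d c = box n].

Lemma box_divisors_uniq n : uniq (box_divisors n).
Proof. exact: fset_uniq. Qed.

Lemma mem_box_divisors n d :
  (d \in box_divisors n) <-> forall i, (d i <= box n i)%N.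
Proof.
rewrite -cm_dvdP /box_divisors in_fset_set; last exact: finite_divisors.
by rewrite inE.
Qed.

Lemma box_divisors_subset n N : (n <= N)%N ->
  {subset box_divisors n <= box_divisors N}.
Proof.
move=> nN d /mem_box_divisors dn; apply/mem_box_divisors => i.
apply: leq_trans (dn i) _; rewrite !boxE.
by case: ltnP => // iN; rewrite (leq_trans iN nN).
Qed.

Lemma box_divisors_cover d : exists n, d \in box_divisors n.
Proof.
exists (\max_(i <- finsupp d) maxn i (d i)).+1; apply/mem_box_divisors => i.
rewrite boxE; have [di|] := boolP (i \in finsupp d); last first.
  by rewrite -cmE_eq0 => /eqP ->.
have le_max : (maxn i (d i) <= \max_(i <- finsupp d) maxn i (d i))%N.
  by rewrite (big_fsetD1 i)//= leq_maxl.
move: le_max; rewrite geq_max => /andP[ii dii].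
by rewrite ltnS ii leqW.
Qed.

(** Summing over all divisors of a monomial makes the seminorm
    submultiplicative, since this set of monomials contains every factor of its
    members. *)
Definition box_seminorm n f : R := \sum_(d <- box_divisors n) normc (f d).

Lemma normcD (a b : R[i]) : normc (a + b) <= normc a + normc b.
Proof. by rewrite -lecR rmorphD /= -!normr_normc ler_normD. Qed.

Lemma normc_sum (T : Type) (r : seq T) (P : pred T) (F : T -> R[i]) :
  normc (\sum_(x <- r | P x) F x) <= \sum_(x <- r | P x) normc (F x).
Proof.
elim/big_rec2: _ => [|x b a _ ab]; first by rewrite ComplexField.Normc.normc0.
by apply: le_trans (normcD _ _) _; rewrite lerD2l.
Qed.

Lemma normc_le_box_seminorm n f d : d \in box_divisors n ->
  normc (f d) <= box_seminorm n f.
Proof.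
move=> dn; rewrite /box_seminorm (bigD1_seq d)//= ?box_divisors_uniq//.
by rewrite lerDl sumr_ge0// => b _; exact: normc_ge0.
Qed.

Lemma box_seminormP n : seminorm (box_seminorm n).
Proof.
split=> [f|f g|a f]; first by apply: sumr_ge0 => d _; exact: normc_ge0.
  by rewrite -big_split /=; apply: ler_sum => d _; exact: normcD.
by rewrite mulr_sumr; apply: eq_bigr => d _; rewrite -ComplexField.Normc.normcM.
Qed.

Lemma box_seminorm_incr n f : box_seminorm n f <= box_seminorm n.+1 f.
Proof.
rewrite /box_seminorm [leRHS](bigID (mem (box_divisors n))) /=.
rewrite -[X in _ <= X + _]big_filter.
rewrite [X in _ <= X + _](perm_big (box_divisors n)) /=.
  by rewrite lerDl sumr_ge0// => d _; exact: normc_ge0.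
apply: uniq_perm; rewrite ?filter_uniq ?box_divisors_uniq// => d.
rewrite mem_filter andb_idr//.
exact: box_divisors_subset.
Qed.

Lemma box_seminormM n : submultiplicative (box_seminorm n).
Proof.
move=> f g; pose s := box_divisors n; pose ss := [seq (b, c) | b <- s, c <- s].
have uss : uniq ss.
  by rewrite allpairs_uniq ?box_divisors_uniq// => -[? ?] [? ?] _ _ [-> ->].
have fgE m : m \in s ->
    (f * g) m = \sum_(bc <- ss | mmul bc.1 bc.2 == m) f bc.1 * g bc.2.
  move=> /mem_box_divisors ms.
  rewrite fps_coefM (fsbigE [seq bc <- ss | mmul bc.1 bc.2 == m]).
  - rewrite big_filter_cond; apply: eq_bigl => -[b c] /=.
    by case: eqP => [bcm|]; rewrite ?andbF//= mem_set.
  - by rewrite filter_uniq.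
  - by move=> [b c] /=; rewrite mem_filter => /andP[/eqP].
  move=> [b c] /= bcm; rewrite mem_filter /= bcm eqxx /= => /negP[].
  apply/allpairsP; exists (b, c); split=> //; apply/mem_box_divisors => i;
    by apply: leq_trans (ms i); rewrite -bcm cmM ?leq_addr ?leq_addl.
rewrite /box_seminorm -/s.
apply: (@le_trans _ _ (\sum_(m <- s) \sum_(bc <- ss | mmul bc.1 bc.2 == m)
    normc (f bc.1) * normc (g bc.2))).
  rewrite big_seq [leRHS]big_seq; apply: ler_sum => m ms; rewrite fgE//.
  apply: le_trans (normc_sum _ _ _) _.
  by apply: ler_sum => bc _; rewrite ComplexField.Normc.normcM.
apply: (@le_trans _ _ (\sum_(bc <- ss) normc (f bc.1) * normc (g bc.2))).
  under eq_bigr do rewrite big_mkcond.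
  rewrite exchange_big /=; apply: ler_sum => bc _.
  rewrite -big_mkcond /=.
  have F0 : 0 <= normc (f bc.1) * normc (g bc.2).
    by rewrite mulr_ge0// normc_ge0.
  have [bcs|bcs] := boolP (mmul bc.1 bc.2 \in s).
    rewrite (big_rem _ bcs) /= eqxx big1_seq ?addr0// => m /andP[/eqP <-].
    by rewrite mem_rem_uniq ?box_divisors_uniq// inE eqxx.
  by rewrite big1_seq// => m /andP[/eqP <-]; rewrite (negbTE bcs).
by rewrite big_allpairs_dep /= mulr_suml; apply: ler_sum => b _;
  rewrite mulr_sumr.
Qed.

Section Cauchy.
Context (T : Type) (F : set_system T) (FF : ProperFilter F).

Lemma real_filter_limit (phi : T -> R) :
    (forall e : R, 0 < e ->
      exists2 B, F B & forall x y, B x -> B y -> `|phi x - phi y| < e) ->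
  exists l : R, forall e : R, 0 < e -> F [set x | `|phi x - l| < e].
Proof.
move=> cphi; have /cauchy_cvg : cauchy ((phi : T -> R^o) @ F).
  apply: cauchy_exP => e e0; have [B FB Be] := cphi e e0.
  have [x Bx] := filter_ex FB; exists (phi x).
  suff: F (phi @^-1` ball (phi x : R^o) e) by [].
  by apply: filterS FB => y By; rewrite /= -ball_normE; exact: (Be x y).
move=> /cvg_ex[l phil]; exists l => e e0.
have FB : F (phi @^-1` ball l e) by exact: phil _ (nbhsx_ballx l e e0).
by apply: filterS FB => x; rewrite /= -ball_normE /= distrC.
Qed.

Lemma complex_filter_limit (phi : T -> R[i]) :
    (forall e : R, 0 < e ->
      exists2 B, F B & forall x y, B x -> B y -> normc (phi x - phi y) < e) ->
  exists l : R[i], forall e : R, 0 < e -> F [set x | normc (phi x - l) < e].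
Proof.
have le_Re (z : R[i]) : `|complex.Re z| <= normc z.
  by rewrite -lecR -normr_normc normc_ge_Re.
have le_Im (z : R[i]) : `|complex.Im z| <= normc z.
  by case: z => a b /=; rewrite -sqrtr_sqr ler_wsqrtr// lerDr sqr_ge0.
have normc_le (z : R[i]) : normc z <= `|complex.Re z| + `|complex.Im z|.
  case: z => a b /=; rewrite -[leRHS]ger0_norm ?addr_ge0// -sqrtr_sqr.
  rewrite ler_wsqrtr// sqrrD !real_normK ?num_real// lerD2r lerDl.
  by rewrite mulrn_wge0// mulr_ge0.
move=> cphi.
have [e e0|k kP] := real_filter_limit (phi := fun x => complex.Re (phi x)).
  have [B FB Be] := cphi e e0; exists B => // x y Bx By.
  apply: le_lt_trans (Be x y Bx By); apply: le_trans (le_Re _).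
  by case: (phi x) (phi y) => ? ? [].
have [e e0|l lP] := real_filter_limit (phi := fun x => complex.Im (phi x)).
  have [B FB Be] := cphi e e0; exists B => // x y Bx By.
  apply: le_lt_trans (Be x y Bx By); apply: le_trans (le_Im _).
  by case: (phi x) (phi y) => ? ? [].
exists (k +i* l)%C => e e0; have e20 : 0 < e / 2 by rewrite divr_gt0.
apply: filterS (filterI (kP _ e20) (lP _ e20)) => x [/= xk xl].
apply: le_lt_trans (normc_le _) _; rewrite [e]splitr.
by move: xk xl; case: (phi x) => a b /= ak bl; rewrite ltrD.
Qed.

End Cauchy.
End BoxSeminorms.

(** * Pulling back, and passing to the direct sum *)

Section PulledBack.
Context (R : realType).
Local Notation F := (fps nat R[i]).
Context (theta theta' : F -> F).
Hypothesis theta_linear : linear theta.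
Hypothesis thetaM : forall f g, theta (f * g) = theta f * theta g.
Hypothesis thetaK : cancel theta theta'.
Hypothesis theta'K : cancel theta' theta.

HB.instance Definition _ := GRing.isLinear.Build R[i] F F _ theta theta_linear.

Let thetaB f g : theta (f - g) = theta f - theta g.
Proof. exact: linearB. Qed.

Definition pulled_seminorm n (f : F) : R := box_seminorm n (theta f).

Lemma pulled_seminormP n : seminorm (pulled_seminorm n).
Proof.
have [q0 qD qZ] := box_seminormP R n.
by split=> [f|f g|a f]; rewrite /pulled_seminorm ?linearD ?linearZ//=.
Qed.

Lemma pulled_seminormM n : submultiplicative (pulled_seminorm n).
Proof. by move=> f g; rewrite /pulled_seminorm thetaM; apply: box_seminormM. Qed.

Lemma pulled_seminorm_incr n f : pulled_seminorm n f <= pulled_seminorm n.+1 f.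
Proof. exact: box_seminorm_incr. Qed.

Lemma pulled_seminorm_separated f : (forall n, pulled_seminorm n f = 0) -> f = 0.
Proof.
move=> f0; rewrite -[f]thetaK -[RHS]thetaK linear0; congr theta'.
apply: fpsP => d; have [n dn] := box_divisors_cover d.
apply: ComplexField.Normc.eq0_normc; apply/eqP.
by rewrite eq_le normc_ge0 andbT -(f0 n) normc_le_box_seminorm.
Qed.

(** The limit is found coefficient by coefficient, then pulled back by the
    inverse of [theta]. *)
Lemma pulled_seminorm_complete (G : set_system F) : ProperFilter G ->
    (forall n (e : R), 0 < e -> exists2 B, G B &
       forall f g, B f -> B g -> pulled_seminorm n (f - g) < e) ->
  exists f, forall n (e : R), 0 < e -> G [set g | pulled_seminorm n (g - f) < e].
Proof.
move=> PG cG.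
have /choice[l lP] d : exists l : R[i], forall e : R, 0 < e ->
    G [set f | normc (theta f d - l) < e].
  apply: complex_filter_limit => e e0; have [n dn] := box_divisors_cover d.
  have [B GB Be] := cG n e e0; exists B => // f g Bf Bg.
  apply: le_lt_trans (Be f g Bf Bg).
  by rewrite /pulled_seminorm thetaB -fps_coefB normc_le_box_seminorm.
exists (theta' (FPS l)) => n e e0.
suff H (s : seq {cmonom nat}) (r : R) : 0 < r ->
    G [set f | \sum_(d <- s) normc (theta f d - l d) < r].
  apply: filterS (H (box_divisors n) e e0) => f /=.
  by rewrite /pulled_seminorm thetaB theta'K.
elim: s r => [|d s IH] r r0; first by apply: filterE => f /=; rewrite big_nil.
have r20 : 0 < r / 2 by rewrite divr_gt0.
apply: filterS (filterI (lP d _ r20) (IH _ r20)) => f [/= fd fs].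
by rewrite big_cons [r]splitr ltrD.
Qed.

Definition pulled_family : frechet_family F :=
  FrechetFamily pulled_seminormP pulled_seminormM pulled_seminorm_incr
    pulled_seminorm_separated pulled_seminorm_complete.

End PulledBack.

Section DirectSumFamily.
Context (R : realType) (A : comAlgType R[i]) (p : frechet_family A).
Implicit Types (u v w : dsum A) (n : nat).

Definition dsum_seminorm n u : R := p n (dsum1 u) + p n (dsum2 u).

Lemma dsum_seminormP n : seminorm (dsum_seminorm n).
Proof.
split=> [u|u v|a u]; first by rewrite addr_ge0 ?fam_ge0.
  by rewrite /dsum_seminorm addrACA lerD// famD.
by rewrite /dsum_seminorm mulrDr -!famZ.
Qed.

Lemma dsum_seminormM n : submultiplicative (dsum_seminorm n).
Proof.
move=> [x y] [x' y']; rewrite /dsum_seminorm /=.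
have := fam_submul p n x x'; have := famD p n (x * y') (x' * y).
have := fam_submul p n x y'; have := fam_submul p n x' y.
have := mulr_ge0 (fam_ge0 p n y) (fam_ge0 p n y').
by rewrite mulrDl !mulrDr (mulrC (p n x') (p n y)); lra.
Qed.

Lemma dsum_seminorm_incr n u : dsum_seminorm n u <= dsum_seminorm n.+1 u.
Proof. by rewrite lerD// fam_incr. Qed.

Lemma dsum_seminorm_separated u : (forall n, dsum_seminorm n u = 0) -> u = 0.
Proof.
move=> u0; case: u u0 => x y u0.
have x0 n : p n x = 0 /\ p n y = 0.
  have := u0 n; rewrite /dsum_seminorm /= => /eqP.
  by rewrite paddr_eq0 ?fam_ge0// => /andP[/eqP ? /eqP].
by congr DSum; apply: (fam_separated (f := p)) => n; have [] := x0 n.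
Qed.

Lemma dsum_seminorm_complete (G : set_system (dsum A)) : ProperFilter G ->
    (forall n (e : R), 0 < e -> exists2 B, G B &
       forall u v, B u -> B v -> dsum_seminorm n (u - v) < e) ->
  exists u, forall n (e : R), 0 < e -> G [set v | dsum_seminorm n (v - u) < e].
Proof.
move=> PG cG.
have cauchy_proj (pr : dsum A -> A) :
    (forall n u v, p n (pr u - pr v) <= dsum_seminorm n (u - v)) ->
    exists x, forall n (e : R), 0 < e -> G [set u | p n (pr u - x) < e].
  move=> pr_le; have [n e e0|x xP] := @fam_complete _ _ p (pr @ G) _.
    have [B GB Be] := cG n e e0; exists (pr @` B).
      suff: G (pr @^-1` (pr @` B)) by [].
      by apply: filterS GB => u Bu; exists u.
    by move=> _ _ [u Bu <-] [v Bv <-]; apply: le_lt_trans (Be u v Bu Bv).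
  by exists x.
have [|x xP] := cauchy_proj (@dsum1 _ _).
  by move=> n u v; rewrite /dsum_seminorm lerDl fam_ge0.
have [|y yP] := cauchy_proj (@dsum2 _ _).
  by move=> n u v; rewrite /dsum_seminorm lerDr fam_ge0.
exists (DSum x y) => n e e0; have e20 : 0 < e / 2 by rewrite divr_gt0.
apply: filterS (filterI (xP n _ e20) (yP n _ e20)) => u [/= ux uy].
by rewrite /dsum_seminorm [e]splitr ltrD.
Qed.

Definition dsum_family : frechet_family (dsum A) :=
  FrechetFamily dsum_seminormP dsum_seminormM dsum_seminorm_incr
    dsum_seminorm_separated dsum_seminorm_complete.

(** This recovers the topology of [A] from that of the direct sum, so that
    distinct topologies on [A] give distinct ones on [dsum A]. *)
Lemma dsum_family_open (U : set A) :
  opens (fam_topology dsum_family) [set u | U (dsum1 u)] <->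
  opens (fam_topology p) U.
Proof.
split=> oU.
  move=> x Ux; have [n [e e0 eU]] := oU (DSum x 0) Ux; exists n, e => // y yx.
  apply: (eU (DSum y 0)); rewrite /fam_ball /= /dsum_seminorm /=.
  by rewrite subr0 fam0 addr0.
move=> u Uu; have [n [e e0 eU]] := oU (dsum1 u) Uu; exists n, e => // v vu.
apply: eU; apply: le_lt_trans vu.
by rewrite /= /dsum_seminorm lerDl fam_ge0.
Qed.

End DirectSumFamily.

(** * Mutually inequivalent topologies *)

(** In the [m]-th topology the partial sums [linform u] of [s] tend to
    [s - m X_0].  All of them have [X_0]-coefficient 1 after applying
    [theta n], but [s - m X_0] has [1 + n - m]. *)
Lemma exists_frechet_families (R : realType) :
  exists p : nat -> frechet_family (fps nat R[i]),
    forall m n, m <> n -> opens (fam_topology (p m)) <> opens (fam_topology (p n)).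
Proof.
have [theta [[theta_lin thetaM thetaD theta0] theta_fin theta_s]] :=
  exists_flow R[i].
have thetaK t : cancel (theta t) (theta (- t)).
  by move=> f; rewrite thetaD addNr theta0.
have thetaNK t : cancel (theta (- t)) (theta t).
  by move=> f; rewrite thetaD addrN theta0.
pose p n := pulled_family (theta_lin n%:R) (thetaM n%:R) (thetaK n%:R)
  (thetaNK n%:R).
exists p => m n mn eq_opens.
pose U : set (fps nat R[i]) := [set f | theta n%:R f (ucm 0%N) <> 1].
have U1 : ucm 0%N \in box_divisors 1.
  by apply/mem_box_divisors => i; rewrite cmU boxE; case: i.
have oU : opens (fam_topology (p n)) U.
  move=> f Uf; exists 1%N, (normc (theta n%:R f (ucm 0%N) - 1)).
    rewrite lt_def normc_ge0 andbT; apply/eqP.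
    by move=> /ComplexField.Normc.eq0_normc/eqP; rewrite subr_eq0 => /eqP.
  move=> g fg gU; move: fg; rewrite /fam_ball /= ltNge => /negP; apply.
  have thetaB : theta n%:R (g - f) = theta n%:R g - theta n%:R f.
    by rewrite -scaleN1r addrC theta_lin addrC scaleN1r.
  have -> : theta n%:R f (ucm 0%N) - 1 = - theta n%:R (g - f) (ucm 0%N).
    by rewrite thetaB fps_coefB gU opprB.
  by rewrite normcN normc_le_box_seminorm.
rewrite -eq_opens in oU.
pose s : fps nat R[i] := linform (fun=> 1).
have [|N [e e0 eU]] := oU (theta (- m%:R) s).
  rewrite /U /= thetaD theta_s fps_coefD fps_coefZ !linformU eqxx mulr1.
  move=> /eqP; rewrite -subr_eq0 addrAC subrr add0r subr_eq0 eqr_nat.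
  by move=> /eqP nm; apply: mn.
pose u i : R[i] := if (i < N.+1)%N then 1 else 0.
have u_fin t : theta t (linform u) = linform u.
  by apply: (theta_fin _ _ N.+1) => i Ni; rewrite /u ltnNge Ni.
have : U (linform u).
  apply: eU; rewrite /fam_ball /= /pulled_seminorm.
  have -> : theta m%:R (linform u - theta (- m%:R) s) = linform u - s.
    by rewrite addrC -scaleN1r theta_lin thetaNK u_fin scaleN1r addrC.
  rewrite /box_seminorm big1_seq// => d /mem_box_divisors dN.
  suff us : linform u d = s d.
    by rewrite fps_coefB us subrr ComplexField.Normc.normc0.
  have [[i di]|nd] := pselect (exists i, d = ucm i); last first.
    by rewrite !linform_notU// => i di; case: nd; exists i.
  have iN : (i < N)%N.
    by have := dN i; rewrite di cmUU boxE; case: (ltnP i N).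
  by rewrite di !linformU /u leqW.
by rewrite /U /= u_fin linformU /u.
Qed.

Theorem mainTheorem1 (R : realType) :
  (exists tau : nat -> topology (fps nat R[i]),
     (forall n, frechet_algebra_topology (tau n)) /\
     (forall m n, m <> n -> opens (tau m) <> opens (tau n))) /\
  (exists tau : nat -> topology (dsum (fps nat R[i])),
     (forall n, frechet_algebra_topology (tau n)) /\
     (forall m n, m <> n -> opens (tau m) <> opens (tau n))).
Proof.
have [p p_neq] := exists_frechet_families R; split.
  exists (fun n => fam_topology (p n)); split=> // n; exact: fam_frechet.
exists (fun n => fam_topology (dsum_family (p n))); split=> [n|m n mn eq_opens].
  exact: fam_frechet.
apply: (p_neq m n mn); apply/seteqP; split=> U.
  by move=> /dsum_family_open oU; apply/dsum_family_open; rewrite -eq_opens.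
by move=> /dsum_family_open oU; apply/dsum_family_open; rewrite eq_opens.
Qed.
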